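(* Let $X$ be a connected Tychonoff space. (i) If $X$ has an irreducible compactification, then $\beta X$ is irreducible. (ii) If $X$ has an indecomposable compactification, then $\beta X$ is indecomposable. (iii) If $X$ is indecomposable, then every irreducible compactification of $X$ is indecomposable.
   Context: $\beta X$ denotes the Stone-Čech compactification of $X$. A compactification of $X$ is a compact Hausdorff space in which $X$ is densely embedded. A continuum is a connected compact Hausdorff space. A topological space $Y$ is indecomposable if every connected subset of $Y$ is either dense or nowhere dense in $Y$; for a continuum this is equivalent to not being the union of two of its proper subcontinua. A composant of a continuum is the union of all its proper subcontinua that contain a given point. A connected space $Y$ is irreducible between two points $p,q\in Y$ if there is no closed connected $C\subsetneq Y$ with $\{p,q\}\subseteq C$. A continuum is irreducible if it has more than one composant, that is, if there are two (distinct) points between which it is irreducible. *)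

(* Defs.v *)
From HB Require Import structures.
From mathcomp Require Import all_boot all_order all_algebra.
From mathcomp Require Import all_classical all_reals all_analysis.
Import Order.TTheory GRing.Theory Num.Theory.
Import numFieldNormedType.Exports.
Set Implicit Arguments.
Unset Strict Implicit.
Unset Printing Implicit Defensive.
Local Open Scope classical_set_scope.
Local Open Scope ring_scope.

(* By uniform_separatorP, completely_regular_space says that a point and a
   closed set not containing it are separated by a continuous map to [0, 1]. *)
Definition tychonoff_space (X : topologicalType) : Prop :=
  hausdorff_space X /\ completely_regular_space X.

(* The second conjunct says that the open sets of X are exactly the preimages
   under e of the open sets of Y; it subsumes the continuity of e. *)
Definition topological_embedding (X Y : topologicalType) (e : X -> Y) : Prop :=
  injective e /\ @open X = @open (initial_topology e).

Definition is_compactification (X K : topologicalType) (e : X -> K) : Prop :=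
  [/\ compact [set: K], hausdorff_space K, topological_embedding e
    & dense (range e)].

Definition continuum (K : topologicalType) : Prop :=
  [/\ compact [set: K], hausdorff_space K & connected [set: K]].

Definition nowhere_dense (Y : topologicalType) (A : set Y) : Prop :=
  (closure A)° = set0.

Definition indecomposable (Y : topologicalType) : Prop :=
  forall A : set Y, connected A -> dense A \/ nowhere_dense A.

(* Subspaces are automatically Hausdorff when K is. *)
Definition proper_subcontinuum (K : topologicalType) (C : set K) : Prop :=
  [/\ C !=set0, compact C, connected C & C <> setT].

Definition composant (K : topologicalType) (p : K) : set K :=
  \bigcup_(C in [set C | proper_subcontinuum C /\ C p]) C.

Definition irreducible_continuum (K : topologicalType) : Prop :=
  continuum K /\ exists p q : K, composant p <> composant q.

(* For connected Y; see irreducible_continuumP for the link with composants. *)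
Definition irreducible_between (Y : topologicalType) (p q : Y) : Prop :=
  ~ exists C : set Y, [/\ closed C, connected C, C <> setT, C p & C q].

(* The Stone-Cech compactification is the closure of the image of X in the cube
   indexed by the continuous maps from X to [0, 1]. The factors of the product
   are R itself: the closure is the same as in the (closed) cube. It is a
   compactification of X by stone_cech_compactification, and it has the
   universal property by stone_cech_extension. *)
Definition unit_fun (R : realType) (X : topologicalType) : Type :=
  {f : X -> R | continuous f /\ forall x, 0 <= f x <= 1}.

Definition cube_eval (R : realType) (X : topologicalType) (x : X) :
    prod_topology (fun _ : unit_fun R X => R) :=
  fun f => sval f x.

Definition stone_cech (R : realType) (X : topologicalType) : topologicalType :=
  set_type (closure (range (@cube_eval R X))).

Definition to_stone_cech (R : realType) (X : topologicalType) (x : X) :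
    stone_cech R X :=
  SigSub (mem_set (subset_closure (imageT (@cube_eval R X) x))).

Lemma continuous_prod_topology (Y : topologicalType) (I : Type)
    (T : I -> topologicalType) (f : Y -> prod_topology T) :
  (forall i, continuous (fun y => f y i)) -> continuous f.
Proof.
move=> cf x; apply/cvg_sup => i; move: x.
apply/(@continuousP _ (initial_topology (fun g : forall i, T i => g i))).
move=> A [B oB <-]; rewrite -comp_preimage.
by have /continuousP := cf i; apply.
Qed.

Lemma set_val_continuous (Y : topologicalType) (A : set Y) :
  continuous (set_val : A -> Y).
Proof. exact: initial_continuous. Qed.

Lemma continuous_set_type (Y Z : topologicalType) (A : set Y) (f : Z -> A) :
  continuous (set_val \o f) -> continuous f.
Proof. by move=> cf; exact: continuous_comp_initial. Qed.

Lemma compact_set_type (Y : topologicalType) (A : set Y) :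
  compact A -> compact [set: A].
Proof.
move=> cA F FF _.
have [|p [Ap clp]] := cA (set_val @ F) _.
  by rewrite /fmap /=; apply: filterS filterT => -[x xA] _ /=; exact: set_mem.
exists (SigSub (mem_set Ap)); split=> // B C FB [D [[V oV <-] Vp sVC]].
have FB' : (set_val @ F) (set_val @` B).
  by rewrite /fmap /=; apply: filterS FB => z Bz; exists z.
have nV : nbhs p V by apply: open_nbhs_nbhs; split.
have [_ [[z Bz <-] Vz]] := clp _ _ FB' nV.
by exists z; split => //; exact: sVC.
Qed.

Lemma inj_continuous_hausdorff (Y Z : topologicalType) (f : Y -> Z) :
  injective f -> continuous f -> hausdorff_space Z -> hausdorff_space Y.
Proof.
move=> fi fc hZ p q clpq; apply/fi/hZ => B C nB nC.
have [z [Bz Cz]] := clpq _ _ (fc _ _ nB) (fc _ _ nC).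
by exists (f z).
Qed.

Lemma embedding_continuous (Y Z : topologicalType) (f : Y -> Z) :
  topological_embedding f -> continuous f.
Proof. by move=> [_ oE]; apply/continuousP => A oA; rewrite oE; exists A. Qed.

Section StoneCech.
Variables (R : realType) (X : topologicalType).

Lemma proj_cube_continuous (f : unit_fun R X) :
  continuous (fun z : prod_topology (fun _ : unit_fun R X => R) => z f).
Proof.
exact: (@proj_continuous {classic unit_fun R X} (fun=> R) f).
Qed.

Lemma cube_eval_continuous : continuous (@cube_eval R X).
Proof.
by apply: continuous_prod_topology => f; case: (svalP f).
Qed.

Lemma cube_closure_sub :
  closure (range (@cube_eval R X)) `<=` [set z | forall f, `[0, 1]%classic (z f)].
Proof.
move=> z + f; rewrite closureE => /(_ ((fun w : prod_topology (fun _ : unit_fun R X => R) => w f) @^-1` `[0, 1]%classic)).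
apply; split.
  by apply: preimage_closed; [move=> ? _; exact: proj_cube_continuous|exact: itv_closed].
by move=> _ [x _ <-] /=; rewrite in_itv /=; case: (svalP f) => _ /(_ x).
Qed.

Lemma stone_cech_compact : compact [set: stone_cech R X].
Proof.
apply: compact_set_type; apply: subclosed_compact cube_closure_sub.
  exact: closed_closure.
apply: (@tychonoff {classic unit_fun R X} (fun=> R) (fun=> `[0, 1]%classic)).
by move=> _; exact: segment_compact.
Qed.

Lemma stone_cech_hausdorff : hausdorff_space (stone_cech R X).
Proof.
apply: (inj_continuous_hausdorff (f := set_val)); first exact: val_inj.
  exact: set_val_continuous.
apply: (@hausdorff_product {classic unit_fun R X} (fun=> R)) => _.
exact: Rhausdorff.
Qed.

Lemma to_stone_cech_continuous : continuous (@to_stone_cech R X).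
Proof. by apply: continuous_set_type; exact: cube_eval_continuous. Qed.

Lemma to_stone_cech_dense : dense (range (@to_stone_cech R X)).
Proof.
move=> O [z Oz] [V oV VO]; case: z Oz => z zcl; rewrite -VO /= => Vz.
have [|_ [[x _ <-] Vx]] := set_mem zcl V; first exact: open_nbhs_nbhs.
by exists (to_stone_cech R x); split.
Qed.

Lemma to_stone_cech_open :
  completely_regular_space X -> @open X = @open (initial_topology (@to_stone_cech R X)).
Proof.
move=> crX; rewrite predeqE => U; split; last first.
  move=> [V oV <-].
  by have /continuousP := @to_stone_cech_continuous; apply.
move=> oU.
exists (\bigcup_(f in [set f : unit_fun R X | forall y, ~ U y -> sval f y = 1])
  [set z : stone_cech R X | set_val z f < 1]).
  apply: bigcup_open => f _.
  have c : continuous (fun z : stone_cech R X => set_val z f).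
    move=> z; apply: (@continuous_comp (stone_cech R X) _ R set_val (fun w => w f)).
      exact: set_val_continuous.
    exact: proj_cube_continuous.
  rewrite -[X in open X]/((fun z : stone_cech R X => set_val z f) @^-1` [set r | r < 1]).
  by move/continuousP : c; apply; exact: open_lt.
rewrite eqEsubset; split=> [x [f fU /=]|x Ux].
  by rewrite set_valE /= /cube_eval => fx; apply: contrapT => /fU fx1; rewrite fx1 ltxx in fx.
have : uniform_separator [set x] (~` U).
  by apply: crX; [exact: open_closedC|move=> /(_ Ux)].
move=> /(uniform_separatorP (R := R))[f [cf f01 fx fU]].
have f01' y : 0 <= f y <= 1 by have := f01 (f y) (imageT _ _); rewrite /= in_itv.
exists (exist _ f (conj cf f01')) => /=.
  by move=> y Uy; apply: fU; exists y.
by rewrite set_valE /= /cube_eval /= (fx (f x)) ?ltr01//; exists x.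
Qed.

Lemma to_stone_cech_inj : tychonoff_space X -> injective (@to_stone_cech R X).
Proof.
move=> [hX crX] x y exy; apply: hX => A B nA nB.
suff nBx : nbhs x B.
  by exists x; split; exact: nbhs_singleton.
move: nB; rewrite nbhsE => -[U [oU Uy] UB]; move: oU; rewrite (to_stone_cech_open crX).
move=> [V oV VU]; rewrite nbhsE; exists U => //; split.
  by rewrite (to_stone_cech_open crX); exists V.
by rewrite -VU /preimage /= exy; have : (@to_stone_cech R X @^-1` V) y by rewrite VU.
Qed.

Lemma stone_cech_compactification : tychonoff_space X ->
  is_compactification (@to_stone_cech R X).
Proof.
move=> tX; split; [exact: stone_cech_compact|exact: stone_cech_hausdorff| |exact: to_stone_cech_dense].
split; [exact: to_stone_cech_inj|by apply: to_stone_cech_open; case: tX].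
Qed.

End StoneCech.

Lemma compact_hausdorff_tychonoff (R : realType) (K : topologicalType) :
  compact [set: K] -> hausdorff_space K -> tychonoff_space K.
Proof.
move=> cK hK; split=> //; apply: (@normal_completely_regular R).
  exact: compact_normal.
exact: hausdorff_accessible.
Qed.

Lemma embedding_cancel_continuous (Y Z W : topologicalType) (f : Y -> Z) (h : W -> Y) :
  topological_embedding f -> continuous (f \o h) -> continuous h.
Proof.
move=> [_ oE] cfh; apply/continuousP => A; rewrite oE => -[B oB <-].
by move/continuousP: cfh => /(_ _ oB).
Qed.

Lemma stone_cech_extension (R : realType) (X K : topologicalType) (f : X -> K) :
  compact [set: K] -> hausdorff_space K -> continuous f ->
  exists g : stone_cech R X -> K, continuous g /\ g \o @to_stone_cech R X = f.
Proof.
move=> cK hK cf; have tK := compact_hausdorff_tychonoff R cK hK.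
have uf (h : unit_fun R K) : continuous (sval h \o f) /\ forall x, 0 <= (sval h \o f) x <= 1.
  case: h => h [ch h01]; split=> [x|x]; last exact: h01.
  by apply: continuous_comp; [exact: cf|exact: ch].
pose G (z : stone_cech R X) : prod_topology (fun _ : unit_fun R K => R) :=
  fun h => set_val z (exist _ _ (uf h)).
have cG : continuous G.
  apply: continuous_prod_topology => h z.
  apply: (@continuous_comp (stone_cech R X) _ R set_val (fun w => w (exist _ _ (uf h)))).
    exact: set_val_continuous.
  exact: proj_cube_continuous.
have Gx x : G (to_stone_cech R x) = cube_eval (f x) by [].
have clK : closed (range (@cube_eval R K)).
  apply: compact_closed.
    apply: (@hausdorff_product {classic unit_fun R K} (fun=> R)) => _.
    exact: Rhausdorff.
  apply: continuous_compact => //.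
  by apply: continuous_subspaceT; exact: cube_eval_continuous.
have GK z : range (@cube_eval R K) (G z).
  have clG : closed (G @^-1` range (@cube_eval R K)).
    by apply: preimage_closed => // ? _; exact: cG.
  apply: contrapT => nz.
  have [|w [nw [x _ xw]]] := @to_stone_cech_dense R X (~` (G @^-1` range (@cube_eval R K))) (ex_intro _ z nz).
    exact: closed_openC.
  by apply: nw; rewrite /= -xw Gx; exists (f x).
pose g z := projT1 (cid2 (GK z)).
have gE z : cube_eval (g z) = G z by rewrite /g; case: (cid2 _).
have [_ _ emb _] := stone_cech_compactification R tK.
have sE (k : K) : set_val (to_stone_cech R k) = cube_eval k by [].
exists g; split.
  apply: (embedding_cancel_continuous emb); apply: continuous_set_type.
  rewrite (_ : _ \o _ = G) //; apply/funext => z.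
  by rewrite /= sE gE.
apply/funext => x /=; case: emb => + _; apply; apply: val_inj.
by rewrite -set_valE !sE gE Gx.
Qed.

Lemma irreducible_continuumP (K : topologicalType) : continuum K ->
  irreducible_continuum K <-> exists p q : K, p <> q /\ irreducible_between p q.
Proof.
move=> [cK hK kK].
have cl C : compact C <-> @closed K C.
  split; first exact: compact_closed.
  by move=> clC; exact: subclosed_compact cK _.
have compE (p q : K) : irreducible_between p q <-> ~ composant p q.
  split; apply: contra_not.
    by move=> [C [[_ cC kC nC] Cp] Cq]; exists C; split=> //; exact/cl.
  by move=> [C [clC kC nC Cp Cq]]; exists C => //; split=> //; split=> //; [exists p|exact/cl].
have refl (p q r : K) : p <> q -> composant r r.
  move=> pq; exists [set r] => //; split => //; split; [by exists r|exact: compact_set1|exact: connected1|].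
  move=> rT; apply: pq.
  have : [set r] p by rewrite rT.
  have : [set r] q by rewrite rT.
  by move=> -> ->.
have sym (p q : K) : composant p q -> composant q p.
  by move=> [C [pC Cp] Cq]; exists C.
split=> [[_ [p [q pq]]]|[p [q [pq /compE npq]]]].
  have [r nr] : exists r, ~ (composant p r <-> composant q r).
    by apply/existsNP => h; apply: pq; rewrite predeqE.
  have pq' : p <> q by move=> e; apply: pq; rewrite e.
  case: (pselect (composant p r)) => pr.
    have nqr : ~ composant q r by move=> qr; apply: nr.
    exists q, r; split; last exact/compE.
    by move=> e; apply: nqr; rewrite -e; exact: refl pq'.
  exists p, r; split; last exact/compE.
  by move=> e; apply: pr; rewrite -e; exact: refl pq'.
split=> //; exists p, q => E; apply: npq; rewrite E; exact: refl pq.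
Qed.

(* Main.v *)
Require Import Defs.
From mathcomp Require Import all_boot all_order all_algebra.
From mathcomp Require Import all_classical all_reals all_analysis.
Local Open Scope classical_set_scope.

(** For (i) and (ii), let [g] be the continuous extension to the Stone-Cech
compactification of the embedding [e] of [X] into a compactification [K]. Over
a point of [X] the fiber of [g] is that point alone ([extension_fiber]), so a
closed set whose image is all of [K] contains [X] and is everything
([extension_irreducible]). A proper closed connected set that refutes
irreducibility, or indecomposability ([indecomposableP]), is therefore sent by [g]
to a proper one that refutes it in [K]; its interior stays nonempty because [X] is
dense in [K].

For (iii), let [K] be irreducible between [p] and [q], and suppose that [K] is
not indecomposable. Then some proper closed connected [H] with nonempty
interior contains one of the two points, say [p]
([somewhere_dense_end_continuum]); so [q] is not in [H]. The point is that the
trace of [closure (~` H)] on [X] is connected ([connected_trace_far_end]),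
although a connected subset of [K] can have a disconnected trace: if it splits
into [A1] and [A2] with [q] in the closure of [A1], then [H] together with the
closure of [A1] is connected, because otherwise a piece of it off [H] would give
a clopen subset of [X] ([connected_dense_glue]). It contains both [p] and [q],
so it is [K], which leaves no room for [A2]. The trace has nonempty interior
because [H] is proper, and is not dense because [H] has nonempty interior, so
[X] is not indecomposable. *)

(** * Closed and connected sets *)

Lemma dense_closed_setT (Y : topologicalType) (A : set Y) :
  dense A -> closed A -> A = setT.
Proof.
move=> dA clA; apply: contrapT => AT.
have [|y [nAy /nAy]] // := dA (~` A) _ (closed_openC clA).
by apply/set0P; apply: contra_notN AT => /eqP A0; rewrite -(setCK A) A0 setC0.
Qed.

Lemma closed_separation (Y : topologicalType) (M H : set Y) :
  closed M -> ~ connected M -> connected H -> H `<=` M ->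
  exists S T : set Y, [/\ closed S /\ closed T, S !=set0 /\ T !=set0,
    M = S `|` T, S `&` T = set0 & H `<=` S].
Proof.
move=> clM /connectedPn[E [E0 ME sepE]] cH HM.
have cl A B : M = A `|` B -> closure A `&` B = set0 -> closed A.
  move=> MAB AB0 y Ay; have : M y.
    by apply: clM; move: y Ay; apply: closureS; rewrite MAB; exact: subsetUl.
  rewrite MAB => -[//|By].
  by have : (closure A `&` B) y by []; rewrite AB0.
have ME' : M = E true `|` E false by rewrite setUC.
have clF : closed (E false) by apply: cl ME _; case: sepE.
have clT : closed (E true) by apply: cl ME' _; rewrite setIC; case: sepE.
have FT0 : E false `&` E true = set0.
  by case: sepE; rewrite -(proj1 (closure_id (E false)) clF).
have [HF|HT] : H `<=` E false \/ H `<=` E true.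
  by apply: connected_subset cH => //; rewrite -ME.
- by exists (E false), (E true).
- by exists (E true), (E false); rewrite setIC.
Qed.

(** The density hypothesis [M `<=` ...] makes every piece of [M] off [H] visible
in [X]; such a piece is then clopen in [X], which is impossible. *)
Lemma connected_dense_glue (X K : topologicalType) (e : X -> K) (H M : set K) :
  continuous e -> dense (range e) -> connected [set: X] ->
  H !=set0 -> connected H -> H `<=` M -> closed M ->
  M `<=` H `|` closure (e @` (e @^-1` M)) -> open (e @^-1` (M `\` H)) ->
  connected M.
Proof.
move=> ce de cX [h Hh] cH HM clM Me oMH; apply: contrapT => ncM.
have [S [T [[clS clT] [_ [t Tt]] MST ST0 HS]]] := closed_separation _ _ _ clM ncM cH HM.
have dST y : S y -> ~ T y.
  by move=> Sy Ty; have : (S `&` T) y by []; rewrite ST0.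
have TE : e @^-1` T = e @^-1` (M `\` H) `&` e @^-1` (~` S).
  rewrite MST eqEsubset; split=> x /=.
    by move=> Tx; split; [split; [right|move=> /HS/dST]|move=> /dST].
  by move=> [[[|]]].
have eT : e @^-1` T = setT.
  apply: cX.
  - have [/HS/dST//|clt] : (H `|` closure (e @` (e @^-1` M))) t.
      by apply: Me; rewrite MST; right.
    have [|_ [[x Mx <-] nSx]] := clt (~` S).
      apply: open_nbhs_nbhs; split; first exact: closed_openC.
      by move=> /dST.
    by exists x; move: Mx; rewrite /= MST => -[].
  - exists (e @^-1` T); rewrite ?setTI // TE; apply: openI => //.
    by move/continuousP: ce; apply; exact: closed_openC.
  - exists (e @^-1` T); rewrite ?setTI //.
    by move/continuous_closedP: ce; apply.
have [|y [nTy [x _ xy]]] := de (~` T) _ (closed_openC clT).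
  by exists h; exact: dST (HS h Hh).
by apply: nTy; rewrite -xy -[T (e x)]/((e @^-1` T) x) eT.
Qed.

(** [P] and [Q] inherit openness from [~` C], so [C `|` P] is closed with [P] open
in [K]: this is gluing along [C] with the identity map as the embedding. *)
Lemma connected_setU_separated_complement (K : topologicalType) (C P Q : set K) :
  connected [set: K] -> closed C -> connected C -> C !=set0 ->
  ~` C = P `|` Q -> separated P Q -> connected (C `|` P) /\ closed (C `|` P).
Proof.
move=> cK clC cC C0 CPQ [PQ QP].
have oC := closed_openC clC.
have PE : P = ~` C `&` ~` closure Q.
  rewrite CPQ eqEsubset; split=> y.
    move=> Py; split; first by left.
    by move=> Qy; have : (P `&` closure Q) y by []; rewrite QP.
  by move=> [[//|/subset_closure Qy] /(_ Qy)].
have QE : Q = ~` C `&` ~` closure P.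
  rewrite CPQ eqEsubset; split=> y.
    move=> Qy; split; first by right.
    by move=> Py; have : (closure P `&` Q) y by []; rewrite PQ.
  by move=> [[/subset_closure Py /(_ Py)|//]].
have oP : open P.
  by rewrite PE; apply: openI => //; apply: closed_openC; exact: closed_closure.
have oQ : open Q.
  by rewrite QE; apply: openI => //; apply: closed_openC; exact: closed_closure.
have nPC y : P y -> ~ C y by rewrite PE => -[].
have clCP : closed (C `|` P).
  rewrite (_ : C `|` P = ~` Q) ?closedC // eqEsubset; split=> y.
    move=> [Cy|Py]; first by rewrite QE => -[].
    by rewrite QE => -[_]; apply; exact: subset_closure.
  move=> nQy; have [|nCy] := pselect (C y); first by left.
  by have : (~` C) y by []; rewrite CPQ => -[|//]; right.
split=> //.
apply: (@connected_dense_glue K K idfun C) => //.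
- by move=> y; exact: cvg_id.
- by move=> O [y Oy] _; exists y; split=> //; exists y.
- by rewrite image_id /=; move=> y /subset_closure; right.
- rewrite preimage_id (_ : _ `\` _ = P) // eqEsubset; split=> y.
    by move=> [[]].
  by move=> Py; split; [right|exact: nPC].
Qed.

(** A connected set that is neither dense nor nowhere dense can be replaced by its
closure, so only closed connected sets need to be tested. *)
Lemma indecomposableP (Y : topologicalType) : indecomposable Y <->
  forall C : set Y, closed C -> connected C -> C° !=set0 -> C = setT.
Proof.
split=> [iY C clC cC [y Cy]|h A cA].
  have [/dense_closed_setT|nd] := iY C cC; first exact.
  by move: nd Cy; rewrite /nowhere_dense -(proj1 (closure_id C) clC) => ->.
have [|nd] := pselect (nowhere_dense A); first by right.
left=> O O0 oO.
have AT : closure A = setT.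
  apply: h; [exact: closed_closure|exact: connected_closure|].
  by apply/set0P; apply: contra_notN nd => /eqP.
have [y Oy] := O0.
have : closure A y by rewrite AT.
by move=> /(_ O (open_nbhs_nbhs (conj oO Oy))); rewrite setIC.
Qed.

(** * Maps extending a compactification *)

(** If [z] differs from [j x], separate the two: the points of [X] near [z] stay
away from [x], so their images under [e] stay away from [e x]. *)
Lemma extension_fiber (X Y K : topologicalType) (j : X -> Y) (e : X -> K)
    (g : Y -> K) (x : X) (z : Y) :
  hausdorff_space Y -> continuous j -> dense (range j) ->
  topological_embedding e -> continuous g -> g \o j = e ->
  g z = e x -> z = j x.
Proof.
move=> hY cj dj [_ oe] cg gj gz; apply/hY => B D nB.
rewrite nbhsE => -[D' [oD' D'x] D'D].
have : open (j @^-1` D') by move/continuousP: cj; apply.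
rewrite oe => -[V oV VE].
have nW : nbhs z (B `&` g @^-1` V).
  apply: filterI => //; apply: cg; apply: open_nbhs_nbhs; split=> //.
  by rewrite gz -[V _]/((e @^-1` V) x) VE.
move: nW; rewrite nbhsE => -[W [oW Wz] WBV].
have [w [/WBV[By Vy] [y _ yE]]] := dj W (ex_intro _ z Wz) oW.
move: By Vy; rewrite -yE /= -[g (j y)]/((g \o j) y) gj => By Vy.
exists (j y); split=> //; apply: D'D.
by rewrite -[D' _]/((j @^-1` D') y) -VE.
Qed.

(** The fibers over the points of [X] are single points, so [C] cannot reach these
points through [g] without containing the points of [X] themselves. *)
Lemma extension_irreducible (X Y K : topologicalType) (j : X -> Y) (e : X -> K)
    (g : Y -> K) (C : set Y) :
  hausdorff_space Y -> continuous j -> dense (range j) ->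
  topological_embedding e -> continuous g -> g \o j = e ->
  closed C -> g @` C = setT -> C = setT.
Proof.
move=> hY cj dj eme cg gj clC gCT; apply: dense_closed_setT => // O O0 oO.
have [y [Oy [x _ xy]]] := dj O O0 oO.
exists y; split=> //.
have [z Cz gz] : (g @` C) (e x) by rewrite gCT.
by rewrite -xy -(extension_fiber _ _ _ _ _ _ _ _ hY cj dj eme cg gj gz).
Qed.

Lemma closed_map_compact_hausdorff (Y K : topologicalType) (g : Y -> K)
    (C : set Y) : compact [set: Y] -> hausdorff_space K -> continuous g ->
  closed C -> closed (g @` C).
Proof.
move=> cY hK cg clC; apply: compact_closed => //.
apply: continuous_compact; first exact: continuous_subspaceT.
exact: subclosed_compact cY _.
Qed.

(** * Irreducible continua that are not indecomposable *)

Lemma irreducible_between_sym (Y : topologicalType) (p q : Y) :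
  irreducible_between p q -> irreducible_between q p.
Proof. by move=> h [C [*]]; apply: h; exists C. Qed.

(** Start from any proper closed connected [C] with nonempty interior. If it
misses both [p] and [q], its complement cannot be connected, for the closure of
the complement would join [p] to [q] without filling the interior of [C]; and
[C] can be enlarged by the piece of the complement that contains [p]. *)
Lemma somewhere_dense_end_continuum (K : topologicalType) (p q : K) :
  connected [set: K] -> irreducible_between p q -> ~ indecomposable K ->
  exists a b (H : set K), [/\ irreducible_between a b, H a & closed H] /\
    [/\ connected H, H° !=set0 & H <> setT].
Proof.
move=> kK pq /indecomposableP/existsNP[C] /not_implyP[clC] /not_implyP[cC].
move=> /not_implyP[[c Cc] CT]; have Cc' := interior_subset Cc.
have qp := irreducible_between_sym _ _ _ pq.
have [Cp|nCp] := pselect (C p); first by exists p, q, C; split; split=> //; exists c.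
have [Cq|nCq] := pselect (C q); first by exists q, p, C; split; split=> //; exists c.
have /connectedPn[E [E0 CE sepE]] : ~ connected (~` C).
  move=> ccC; apply: pq; exists (closure (~` C)); split.
  - exact: closed_closure.
  - exact: connected_closure.
  - rewrite closure_setC => cT; have : (~` C°) c by rewrite cT.
    by apply.
  - exact: subset_closure.
  - exact: subset_closure.
have main P Q : ~` C = P `|` Q -> separated P Q -> Q !=set0 -> P p ->
    exists a b (H : set K), [/\ irreducible_between a b, H a & closed H] /\
    [/\ connected H, H° !=set0 & H <> setT].
  move=> CPQ sPQ [z Qz] Pp.
  have [|cCP clCP] := connected_setU_separated_complement _ _ _ _ kK clC cC _ CPQ sPQ.
    by exists c.
  exists p, q, (C `|` P); split; split=> //; first by right.
    by exists c; move: c Cc {Cc'}; apply: interiorS; exact: subsetUl.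
  move=> CPT; have [Cz|Pz] : (C `|` P) z by rewrite CPT.
    by have : (~` C) z by rewrite CPQ; right.
  have [_ PQ0] := sPQ.
  have : (P `&` closure Q) z by split=> //; exact: subset_closure.
  by rewrite PQ0.
have : (~` C) p by [].
rewrite CE => -[Ep|Ep]; [apply: (main _ _ CE)|apply: (main (E true) (E false))] => //.
- by rewrite setUC.
- by case: sepE => E1 E2; split; rewrite setIC.
Qed.

(** * Traces of closed sets on the dense subspace *)

(** Of a separation of the trace, let [A1] be the part whose closure in [K] contains
[b]. Glued to [H], this closure joins [a] to [b], hence fills [K], and the closure
of [A1] then contains all of [~` H], in particular the points of [A2]. Openness of
the glued part in [X] comes from [A2] being closed. *)
Lemma connected_trace_far_end (X K : topologicalType) (e : X -> K) (a b : K)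
    (H : set K) :
  topological_embedding e -> dense (range e) -> connected [set: X] ->
  irreducible_between a b -> closed H -> connected H -> H <> setT -> H a ->
  connected (e @^-1` closure (~` H)).
Proof.
move=> eme de cX ab clH cH HT Ha.
have ce := embedding_continuous eme.
have pre_cl F : closed F -> closed (e @^-1` F).
  by move/continuous_closedP: ce; apply.
have Hb : ~ H b by move=> Hb; apply: ab; exists H.
set A := e @^-1` closure (~` H).
have AH x : ~ H (e x) -> A x by move=> nH; exact: subset_closure.
have clA : closed A by apply: pre_cl; exact: closed_closure.
(* As e is an embedding, a closed subset of X is the trace of its closure in K. *)
have tr A1 x : closed A1 -> closure (e @` A1) (e x) -> A1 x.
  move=> clA1; have : open (~` A1) by exact: closed_openC.
  have [_ ->] := eme => -[V oV VE] cl1; apply: contrapT => nA1.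
  have [|_ [[y A1y <-] Vy]] := cl1 V.
    by apply: open_nbhs_nbhs; split=> //; rewrite -[V _]/((e @^-1` V) x) VE.
  by have : (e @^-1` V) y by []; rewrite VE.
apply: contrapT => ncA.
have main A1 A2 : closed A1 -> closed A2 -> A2 !=set0 -> A = A1 `|` A2 ->
    A1 `&` A2 = set0 -> closure (e @` A1) b -> False.
  move=> clA1 clA2 [x A2x] AE A12 A1b.
  have MT : H `|` closure (e @` A1) = setT.
    apply: contrapT => MT; apply: ab; exists (H `|` closure (e @` A1)).
    have clM : closed (H `|` closure (e @` A1)).
      by apply: closedU => //; exact: closed_closure.
    split=> //; [|by left|by right].
    apply: (connected_dense_glue _ _ e H) => //; first by exists a.
    - apply: setUS; apply: closureS => _ [y A1y <-]; exists y => //=.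
      by right; apply: subset_closure; exists y.
    - rewrite (_ : _ @^-1` _ = e @^-1` (~` H) `&` ~` A2).
        apply: openI; last exact: closed_openC.
        by move/continuousP: ce; apply; exact: closed_openC.
      rewrite eqEsubset; split=> y /=.
        move=> [[//|/(tr _ _ clA1) A1y] nHy]; split=> // A2y.
        by have : (A1 `&` A2) y by []; rewrite A12.
      move=> [nHy nA2y]; split=> //; right.
      have := AH _ nHy; rewrite AE => -[A1y|//].
      by apply: subset_closure; exists y.
  have HA1 : closure (~` H) `<=` closure (e @` A1).
    rewrite (proj1 (closure_id (closure (e @` A1))) (@closed_closure _ _)).
    apply: closureS => y nHy.
    by have [/nHy//|//] : (H `|` closure (e @` A1)) y by rewrite MT.
  have A1x : A1 x.
    by apply: (tr A1) => //; apply: HA1; have : A x by rewrite AE; right.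
  by have : (A1 `&` A2) x by []; rewrite A12.
have Ab : closure (e @` A) b.
  move=> B; rewrite nbhsE => -[W [oW Wb] WB].
  have [|y [[Wy nHy] [x _ xy]]] := de (W `&` ~` H) _ (openI oW (closed_openC clH)).
    by exists b.
  exists (e x); split; last by rewrite xy; exact: WB.
  by exists x => //; apply: AH; rewrite xy.
have [A1 [A2 [[cl1 cl2] [A10 A20] AE A12 _]]] :=
  closed_separation _ _ _ clA ncA (@connected0 X) (@sub0set _ A).
move: Ab; rewrite AE image_setU closureU => -[b1|b2].
- exact: (main A1 A2).
- by apply: (main A2 A1) => //; rewrite 1?setUC 1?setIC.
Qed.

(** The trace of [closure (~` H)] on [X] would be connected with nonempty interior,
hence all of [X], whereas the interior of [H] contains points of [X]. *)
Lemma indecomposable_compactification (X K : topologicalType) (e : X -> K) :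
  connected [set: X] -> is_compactification e -> indecomposable X ->
  irreducible_continuum K -> indecomposable K.
Proof.
move=> cX [_ _ eme de] /indecomposableP iX iK.
have cK := iK.1; have [_ _ kK] := cK.
have [p [q [_ pq]]] := proj1 (irreducible_continuumP cK) iK.
apply: contrapT => nK.
have [a [b [H [[ab Ha clH] [cH H0 HT]]]]] :=
  somewhere_dense_end_continuum _ _ _ kK pq nK.
have ce := embedding_continuous eme.
have AT : e @^-1` closure (~` H) = setT.
  apply: iX.
  - by move/continuous_closedP: ce; apply; exact: closed_closure.
  - exact: connected_trace_far_end ab clH cH HT Ha.
  - have [|y [nHy [x _ xy]]] := de (~` H) _ (closed_openC clH).
      by apply/set0P; apply: contra_notN HT => /eqP E; rewrite -(setCK H) E setC0.
    exists x; apply: (@filterS _ (nbhs x) _ (e @^-1` (~` H))).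
      by move=> w /= nHw; exact: subset_closure.
    apply: open_nbhs_nbhs; split; last by rewrite /= xy.
    by move/continuousP: ce; apply; exact: closed_openC.
have [y [Hy [x _ xy]]] := de _ H0 (open_interior H).
have : (e @^-1` closure (~` H)) x by rewrite AT.
by rewrite /= xy closure_setC.
Qed.

(** * Irreducible and indecomposable compactifications *)

Theorem theorem6 (R : realType) (X : topologicalType)
    (tychX : tychonoff_space X) (connX : connected [set: X]) :
  [/\ (exists (K : topologicalType) (e : X -> K),
         is_compactification e /\ irreducible_continuum K) ->
      irreducible_continuum (stone_cech R X),
      (exists (K : topologicalType) (e : X -> K),
         is_compactification e /\ indecomposable K) ->
      indecomposable (stone_cech R X)
    & indecomposable X ->
      forall (K : topologicalType) (e : X -> K),
        is_compactification e -> irreducible_continuum K -> indecomposable K].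
Proof.
have [cB hB [_ _] dj] := stone_cech_compactification R tychX.
have cj := @to_stone_cech_continuous R X.
have kB : connected [set: stone_cech R X].
  rewrite -(dense_closed_setT _ (closure (range (@to_stone_cech R X)))).
  - apply: connected_closure; apply: connected_continuous_connected => //.
    exact: continuous_subspaceT.
  - move=> O O0 oO; have [y [Oy ry]] := dj O O0 oO.
    by exists y; split=> //; exact: subset_closure.
  - exact: closed_closure.
split; last by move=> iX K e cpt; exact: (indecomposable_compactification _ _ e).
- move=> [K [e [[cK hK eme de] iK]]].
  have [g [cg gj]] := stone_cech_extension R cK hK (embedding_continuous eme).
  have gT C : closed C -> g @` C = setT -> C = setT.
    exact: (extension_irreducible _ _ _ _ e g).
  have gonto : g @` setT = setT.
    apply: dense_closed_setT.
      move=> O O0 oO; have [y [Oy [x _ xy]]] := de O O0 oO.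
      exists y; split=> //; exists (to_stone_cech R x) => //.
      by rewrite -xy -gj.
    exact: closed_map_compact_hausdorff.
  have [p [q [npq pq]]] := proj1 (irreducible_continuumP iK.1) iK.
  have [p' _ gp] : (g @` setT) p by rewrite gonto.
  have [q' _ gq] : (g @` setT) q by rewrite gonto.
  apply/irreducible_continuumP => //; exists p', q'; split.
    by move=> E; apply: npq; rewrite -gp -gq E.
  move=> [C [clC cC CT Cp Cq]]; apply: pq; exists (g @` C); split.
  + exact: closed_map_compact_hausdorff.
  + by apply: connected_continuous_connected => //; exact: continuous_subspaceT.
  + by move=> /(gT _ clC).
  + by exists p'.
  + by exists q'.
- move=> [K [e [[cK hK eme de] /indecomposableP iK]]].
  have [g [cg gj]] := stone_cech_extension R cK hK (embedding_continuous eme).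
  apply/indecomposableP => C clC cC C0.
  apply: (extension_irreducible _ _ _ _ e g _ hB cj dj) => //.
  have clgC : closed (g @` C) by exact: closed_map_compact_hausdorff.
  apply: iK => //.
    by apply: connected_continuous_connected => //; exact: continuous_subspaceT.
  have [y [Cy [x _ xy]]] := dj _ C0 (open_interior C).
  have : open (to_stone_cech R (X:=X) @^-1` C°).
    by move/continuousP: cj; apply; exact: open_interior.
  have [_ ->] := eme => -[V oV VE].
  (* V lies in the closed set g @` C: the points of X in V are dense in V, and they
     are images of points of C. *)
  exists (e x); rewrite /interior nbhsE /=; exists V.
    by split=> //; rewrite -[V _]/((e @^-1` V) x) VE /= xy.
  move=> k Vk; apply: clgC => O; rewrite nbhsE => -[W [oW Wk] WO].
  have [|l [[Wl Vl] [w _ wl]]] := de (W `&` V) _ (openI oW oV).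
    by exists k.
  rewrite -{}wl in Wl Vl.
  exists (e w); split; last exact: WO.
  have Cw : (to_stone_cech R (X:=X) @^-1` C°) w by rewrite -VE.
  exists (to_stone_cech R w); first exact: interior_subset Cw.
  by rewrite -gj.
Qed.
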